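(* Let $k\ge 1$ be an integer and let $T_k(z)=\sum_{i\ge 0}|\mathcal{M}_{F_{k,i}}|\,z^i$ be the generating function of $k$-Fibonacci paths by length. Then, as formal power series, \[ T_k(z)=\frac{1-(k+1)z-z^2-\sqrt{(1-(k+1)z-z^2)^2-4z^2(1-kz-z^2)^2}}{2z^2(1-kz-z^2)} =\cfrac{1}{1-\frac{z}{1-kz-z^2}-\cfrac{z^2}{1-\frac{z}{1-kz-z^2}- \cfrac{z^2}{1-\frac{z}{1-kz-z^2} -\cfrac{z^2}{\ddots}}}}, \] and for every integer $t\ge 0$, \[ [z^t]\,T_k(z)=\sum_{n=0}^{t}\sum_{m=0}^{t-2n}\binom{m+2n}{m}C_n\,F_{k,t-2n-m+1}^{(m)} . \]
   Context: For a positive integer $k$, the $k$-Fibonacci numbers are defined by $F_{k,0}=0$, $F_{k,1}=1$, $F_{k,n+1}=kF_{k,n}+F_{k,n-1}$ for $n\ge1$; their generating function is $\sum_n F_{k,n}x^n=\frac{x}{1-kx-x^2}$. A $k$-Fibonacci path of length $n$ is a lattice path in $\mathbb{Z}\times\mathbb{Z}$ from $(0,0)$ to $(n,0)$ that never passes below the $x$-axis, built from rise steps $U=(1,1)$, fall steps $D=(1,-1)$, and horizontal steps $H_l=(l,0)$ for any positive integer $l$, where each step $H_l$ is additionally assigned one of $F_{k,l}$ colors (paths with the same steps but different colorings are counted as different). $\mathcal{M}_{F_{k,n}}$ denotes the set of such (colored) paths of length $n$; the empty path is the unique one of length $0$. $C_n=\frac{1}{n+1}\binom{2n}{n}$ is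 the $n$-th Catalan number. The convolved $k$-Fibonacci numbers $F^{(r)}_{k,j}$ (for integers $r\ge0$, $j\ge1$) are defined by $(1-kx-x^2)^{-r}=\sum_{j\ge0}F^{(r)}_{k,j+1}x^j$ (so $F^{(0)}_{k,1}=1$ and $F^{(0)}_{k,j}=0$ for $j\ge2$). The square root denotes the formal power series square root with constant term $1$, and the infinite continued fraction is understood as the limit (in the formal power series topology) of its finite truncations. *)

(* Defs.v *)
From HB Require Import structures.
From mathcomp Require Import all_boot all_order all_algebra.
From mathcomp Require Import finmap.
From mathcomp Require Import boolp classical_sets functions cardinality.

Set Implicit Arguments.
Unset Strict Implicit.
Unset Printing Implicit Defensive.

Import Order.TTheory GRing.Theory Num.Theory.

Local Open Scope ring_scope.

Record fps (R : Type) := Fps { coefs : nat -> R }.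

(* [coefs_rec G] is the sequence a with a_n = G [:: a_0; ...; a_(n-1)]. *)
Fixpoint prefix_rec (R : Type) (G : seq R -> R) (n : nat) : seq R :=
  if n is m.+1 then rcons (prefix_rec G m) (G (prefix_rec G m)) else [::].

Definition coefs_rec (R : Type) (G : seq R -> R) (n : nat) : R :=
  G (prefix_rec G n).

Lemma prefix_recE (R : Type) (G : seq R -> R) n :
  prefix_rec G n = mkseq (coefs_rec G) n.
Proof. by elim: n => //= n IHn; rewrite mkseqS -IHn. Qed.

Lemma fpsP (R : Type) (f g : fps R) : coefs f =1 coefs g <-> f = g.
Proof.
split=> [|->] //; case: f g => [f] [g] /= fg.
by congr Fps; apply: funext.
Qed.

HB.instance Definition _ (R : Type) := gen_eqMixin (fps R).
HB.instance Definition _ (R : Type) := gen_choiceMixin (fps R).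

Section FpsRing.
Variable R : fieldType.
Implicit Types f g h : fps R.

Definition fps_zero : fps R := Fps (fun=> 0).
Definition fps_one : fps R := Fps (fun n => (n == 0%N)%:R).
Definition fps_add f g : fps R := Fps (fun n => coefs f n + coefs g n).
Definition fps_opp f : fps R := Fps (fun n => - coefs f n).
Definition fps_mul f g : fps R :=
  Fps (fun n => \sum_(i < n.+1) coefs f i * coefs g (n - i)).

Let tr N f : {poly R} := \poly_(i < N) coefs f i.

Let trE N f n : (n < N)%N -> (tr N f)`_n = coefs f n.
Proof. by move=> nN; rewrite coef_poly nN. Qed.

Let tr_mul N f g n : (n < N)%N -> (tr N f * tr N g)`_n = coefs (fps_mul f g) n.
Proof.
move=> nN; rewrite coefM /=; apply: eq_bigr => i _.
rewrite !trE ?(leq_ltn_trans (leq_subr _ _) nN) //.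
by apply: leq_ltn_trans nN; rewrite -ltnS.
Qed.

Let fps_addA : associative fps_add.
Proof. by move=> f g h; apply/fpsP => n /=; rewrite addrA. Qed.
Let fps_addC : commutative fps_add.
Proof. by move=> f g; apply/fpsP => n /=; rewrite addrC. Qed.
Let fps_add0 : left_id fps_zero fps_add.
Proof. by move=> f; apply/fpsP => n /=; rewrite add0r. Qed.
Let fps_addN : left_inverse fps_zero fps_opp fps_add.
Proof. by move=> f; apply/fpsP => n /=; rewrite addNr. Qed.

HB.instance Definition _ :=
  GRing.isZmodule.Build (fps R) fps_addA fps_addC fps_add0 fps_addN.

Let fps_mulC : commutative fps_mul.
Proof.
by move=> f g; apply/fpsP => n; rewrite -!(tr_mul _ _ (ltnSn n)) mulrC.
Qed.

Let fps_mulA : associative fps_mul.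
Proof.
move=> f g h; apply/fpsP => n.
transitivity ((tr n.+1 f * (tr n.+1 g * tr n.+1 h))`_n).
  rewrite coefM /=; apply: eq_bigr => i _; rewrite trE ?ltn_ord // tr_mul //.
  by rewrite ltnS leq_subr.
rewrite mulrA coefM /=; apply: eq_bigr => i _.
by rewrite tr_mul ?ltn_ord // trE // ltnS leq_subr.
Qed.

Let fps_mul1 : left_id fps_one fps_mul.
Proof.
move=> f; apply/fpsP => n /=; rewrite big_ord_recl /= mul1r subn0 big1 ?addr0 //.
by move=> i _; rewrite mul0r.
Qed.

Let fps_mulDl : left_distributive fps_mul fps_add.
Proof.
move=> f g h; apply/fpsP => n /=; rewrite -big_split /=.
by apply: eq_bigr => i _; rewrite mulrDl.
Qed.

Let fps_one_neq0 : fps_one != fps_zero.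
Proof.
by apply/eqP => /fpsP /(_ 0%N) /= /eqP; rewrite oner_eq0.
Qed.

HB.instance Definition _ :=
  GRing.Zmodule_isComNzRing.Build (fps R)
    fps_mulA fps_mulC fps_mul1 fps_mulDl fps_one_neq0.

Lemma coefs0 n : coefs (0 : fps R) n = 0. Proof. by []. Qed.
Lemma coefs1 n : coefs (1 : fps R) n = (n == 0%N)%:R. Proof. by []. Qed.
Lemma coefsD f g n : coefs (f + g) n = coefs f n + coefs g n.
Proof. by []. Qed.
Lemma coefsN f n : coefs (- f) n = - coefs f n. Proof. by []. Qed.
Lemma coefsM f g n :
  coefs (f * g) n = \sum_(i < n.+1) coefs f i * coefs g (n - i).
Proof. by []. Qed.

Lemma coefs0M f g : coefs (f * g) 0 = coefs f 0 * coefs g 0.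
Proof. by rewrite coefsM big_ord1. Qed.

Definition fps_unit : pred (fps R) := fun f => coefs f 0 != 0.

Definition fps_inv f : fps R :=
  if coefs f 0 == 0 then f else
  Fps (coefs_rec (fun s => let n := size s in
    if n == 0%N then (coefs f 0)^-1 else
    - (coefs f 0)^-1 * \sum_(i < n) coefs f (n - i) * s`_i)).

Let fps_mulV : {in fps_unit, left_inverse 1 fps_inv *%R}.
Proof.
move=> f; rewrite unfold_in => f0; rewrite /fps_inv (negPf f0).
apply/fpsP => n; rewrite coefsM coefs1 /= big_ord_recr /= subnn.
rewrite {2}/coefs_rec prefix_recE size_mkseq.
case: n => [|n] /=; first by rewrite big_ord0 add0r mulVf.
rewrite mulNr mulNr -mulrA [_ * coefs f 0]mulrC mulKf //.
apply/eqP; rewrite subr_eq0; apply/eqP; apply: eq_bigr => i _.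
by rewrite mulrC -[RHS]mulrC nth_mkseq ?ltn_ord // mulrC.
Qed.

Let fps_unitP f g : g * f = 1 -> fps_unit f.
Proof.
move/(congr1 (fun h => coefs h 0)); rewrite coefs0M coefs1 eqxx => gf1.
by apply/eqP => f0; move/eqP: gf1; rewrite f0 mulr0 eq_sym oner_eq0.
Qed.

Let fps_inv_out : {in [predC fps_unit], fps_inv =1 id}.
Proof.
by move=> f; rewrite inE unfold_in negbK /fps_inv => /eqP ->; rewrite eqxx.
Qed.

HB.instance Definition _ :=
  GRing.ComNzRing_hasMulInverse.Build (fps R) fps_mulV fps_unitP fps_inv_out.

Lemma fps_unitE f : (f \is a GRing.unit) = (coefs f 0 != 0).
Proof. by []. Qed.

Let fps_neq0 f : f != 0 ->
  exists2 n, coefs f n != 0 & forall i, (i < n)%N -> coefs f i = 0.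
Proof.
move=> f0; have ex_n : exists n, coefs f n != 0.
  apply: contrapT => /forallNP nf; case/eqP: f0; apply/fpsP => n.
  by apply/eqP; rewrite -[_ == _]negbK; apply/negP/nf.
case: (ex_minnP ex_n) => n fn min_n; exists n => // i i_n.
by apply/eqP; apply: contraTT i_n => /min_n; rewrite -leqNgt.
Qed.

Let fps_integral : GRing.integral_domain_axiom (fps R).
Proof.
move=> f g fg0; apply/norP => -[/fps_neq0[m fm minm] /fps_neq0[n gn minn]].
move/fpsP/(_ (m + n)%N): fg0 => /eqP; apply/negP.
have m_mn : (m < (m + n).+1)%N by rewrite ltnS leq_addr.
rewrite coefsM (bigD1 (Ordinal m_mn)) //= addKn big1 ?addr0 ?mulf_neq0 // => i.
rewrite -val_eqE /= neq_ltn => /orP[/minm -> | mi]; first by rewrite mul0r.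
by rewrite [X in _ * X]minn ?mulr0 // ltn_subLR ?ltn_add2r // -ltnS ltn_ord.
Qed.

HB.instance Definition _ :=
  GRing.ComUnitRing_isIntegral.Build (fps R) fps_integral.

Definition fpsX : fps R := Fps (fun n => (n == 1%N)%:R).

Definition fps_sqrt f : fps R :=
  Fps (coefs_rec (fun s => let n := size s in
    if n == 0%N then 1 else
    (coefs f n - \sum_(1 <= i < n) s`_i * s`_(n - i)) / 2%:R)).

Lemma coefs0_sqrt f : coefs (fps_sqrt f) 0 = 1. Proof. by []. Qed.

Lemma sqr_fps_sqrt f : 2%:R != 0 :> R -> coefs f 0 = 1 -> fps_sqrt f ^+ 2 = f.
Proof.
move=> nz2 f0; apply/fpsP => -[|n]; rewrite expr2.
  by rewrite coefs0M coefs0_sqrt mulr1 f0.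
set a := coefs (fps_sqrt f).
have aE : a n.+1 = (coefs f n.+1 -
    \sum_(i < n) a i.+1 * a (n - i)%N) / 2%:R.
  rewrite {1}/a /= /coefs_rec prefix_recE size_mkseq; cbv zeta.
  rewrite (_ : (n.+1 == 0%N) = false) // big_add1 big_mkord.
  congr ((_ - _) / _); apply: eq_bigr => i _.
  by rewrite subSS !nth_mkseq ?ltnS ?leq_subr.
have a0 : a 0%N = 1 by rewrite /a coefs0_sqrt.
rewrite coefsM -/a; clearbody a.
rewrite big_ord_recl big_ord_recr /= subnn subn0 a0 mul1r mulr1.
under eq_bigr do rewrite /bump add1n subSS.
rewrite /bump add1n addrCA -mulr2n -mulr_natr aE mulfVK //.
by rewrite addrC subrK.
Qed.

Lemma fps_sqrt_uniq f g : 2%:R != 0 :> R ->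
  coefs g 0 = 1 -> g ^+ 2 = f -> g = fps_sqrt f.
Proof.
move=> nz2 g0 gf; have f0 : coefs f 0 = 1 by rewrite -gf expr2 coefs0M g0 mulr1.
have /eqP := sqr_fps_sqrt nz2 f0; rewrite -{2}gf eqf_sqr => /orP[/eqP->//|/eqP].
move/(congr1 (fun h => coefs h 0)); rewrite coefs0_sqrt coefsN g0 => /eqP.
by rewrite -subr_eq0 opprK -[1 + 1]/(2%:R) (negPf nz2).
Qed.

(* Convergence in the X-adic topology. *)
Definition fps_cvg (u : nat -> fps R) (l : fps R) : Prop :=
  forall N, exists M, forall m, (M <= m)%N ->
    forall i, (i < N)%N -> coefs (u m) i = coefs l i.

(* [cfrac a b i n] is the truncation to n partial quotients of
   a_i / (b_i + a_(i+1) / (b_(i+1) + ...)). *)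
Fixpoint cfrac (a b : nat -> fps R) (i n : nat) : fps R :=
  if n is m.+1 then a i / (b i + cfrac a b i.+1 m) else 0.

End FpsRing.
Arguments fpsX {R}.

Fixpoint kfib (k n : nat) : nat :=
  match n with
  | 0 => 0
  | 1 => 1
  | (m.+1 as n').+1 => k * kfib k n' + kfib k m
  end%N.

Definition kfib_den (k : nat) : fps rat := 1 - k%:R * fpsX - fpsX ^+ 2.

(* For j >= 1; [x ^- r] is the inverse of [x ^+ r]. *)
Definition conv_kfib (k r j : nat) : rat := coefs (kfib_den k ^- r) j.-1.

Definition catalan (n : nat) : rat := 'C((2 * n)%N, n)%:R / n.+1%:R.

(* [Hor l c] is the horizontal step of length l with colour c. *)
Inductive step := Up | Down | Hor of nat & nat.

Definition step_code (s : step) : bool + nat * nat :=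
  match s with Up => inl true | Down => inl false | Hor l c => inr (l, c) end.
Definition step_decode (x : bool + nat * nat) : step :=
  match x with
  | inl true => Up | inl false => Down | inr (l, c) => Hor l c
  end.
Lemma step_codeK : cancel step_code step_decode.
Proof. by case. Qed.
HB.instance Definition _ := Countable.copy step (can_type step_codeK).

(* The colours of a horizontal step of length l are 0, ..., F_(k,l) - 1. *)
Definition valid_step (k : nat) (s : step) : bool :=
  if s is Hor l c then (0 < l)%N && (c < kfib k l)%N else true.

Definition step_vec (s : step) : int * int :=
  match s with
  | Up => (1, 1)
  | Down => (1, -1)
  | Hor l _ => (l%:Z, 0)
  end.

Definition endpoint (p : seq step) : int * int := \sum_(s <- p) step_vec s.

Local Open Scope classical_set_scope.

Definition kfib_paths (k n : nat) : set (seq step) :=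
  [set p | [/\ all (valid_step k) p,
               endpoint p = (n%:Z, 0)
             & forall i, 0 <= (endpoint (take i p)).2]].

Lemma finite_kfib_paths k n : finite_set (kfib_paths k n).
Proof.
pose S : seq step := [:: Up, Down &
  flatten [seq [seq Hor l c | c <- iota 0 (kfib k l)] | l <- iota 0 n.+1]].
have SP s : valid_step k s -> (step_vec s).1 <= n%:Z -> s \in S.
  case: s => [||l c] //= /andP[_ cl]; rewrite lez_nat => ln; rewrite !inE; apply/orP; right.
  apply/orP; right; apply/flatten_mapP; exists l; first by rewrite mem_iota.
  by apply/mapP; exists c; rewrite ?mem_iota.
have ge1 s : valid_step k s -> 1 <= (step_vec s).1.
  by case: s => // l c /= /andP[l0 _]; rewrite lez_nat.
have end1 p : (endpoint p).1 = \sum_(s <- p) (step_vec s).1.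
  by rewrite /endpoint; elim: p => [|s p IHp]; rewrite ?big_nil // !big_cons -IHp.
have size_end p : all (valid_step k) p -> (size p)%:Z <= (endpoint p).1.
  rewrite end1; elim: p => [|s p IHp] /=; first by rewrite big_nil.
  move=> /andP[vs /IHp le_p]; rewrite big_cons -add1n PoszD.
  by apply: lerD => //; apply: ge1.
have step_end p : all (valid_step k) p ->
    forall s, s \in p -> (step_vec s).1 <= (endpoint p).1.
  move=> /allP vp s sp; rewrite end1 (perm_big _ (perm_to_rem sp)) big_cons /=.
  rewrite lerDl big_seq; apply: sumr_ge0 => t /mem_rem /vp /ge1.
  exact: le_trans.
pose im (b : n.-bseq (seq_sub S)) : seq step := [seq val s | s <- b].
apply: (@sub_finite_set _ _ [set im b | b in [set: n.-bseq (seq_sub S)]]).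
  move=> p [vp pn _].
  have /allP pS : {in p, forall s, s \in S}.
    move=> s sp; apply: SP; first exact: (allP vp).
    by have := step_end _ vp _ sp; rewrite pn.
  have size_p : (size p <= n)%N by have := size_end _ vp; rewrite pn lez_nat.
  have [q qp] : exists q : seq (seq_sub S), [seq val s | s <- q] = p.
    elim: p pS {vp pn size_p} => [|s p IHp] /=; first by exists [::].
    by case/andP=> sS /IHp[q <-]; exists (SeqSub sS :: q).
  have size_q : (size q <= n)%N by rewrite -(size_map val) qp.
  by exists (Bseq size_q).
by apply: finite_image; apply: finite_finset.
Qed.

(* [fset_set] is meaningful here by [finite_kfib_paths]. *)
Definition kfib_path_gf (k : nat) : fps rat :=
  Fps (fun i => #|` fset_set (kfib_paths k i)|%:R).

(* Main.v *)
(** Let Q = 1 - kz - z^2, P = Q - z and b = P/Q = 1 - z/Q, where z/Q is the generating function of the numbers F_(k,l)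
    of colours. Splitting off the first step, the paths of length n going from
    height h down to 0 are counted by the coefficients of z^h T^(h+1) for any
    series T with b T = 1 + z^2 T^2, since these satisfy the same recursion; hence
    such a T is the generating function of the paths. The rationalized form
    2Q/(P + sqrt(P^2 - 4z^2Q^2)) of the closed formula solves this equation. The
    continued fraction converges to T because its tail d satisfies d + z^2 T = 0
    modulo a power of z that grows by z^2 with each further level. Finally,
    T = b^-1 c(z^2 b^-2), where c is the Catalan series, and expanding
    b^-(2n+1) in powers of z/Q gives the double sum. *)

Require Import Defs.
From HB Require Import structures.
From mathcomp Require Import all_boot all_order all_algebra.
From mathcomp Require Import finmap.
From mathcomp Require Import boolp classical_sets functions cardinality.
From mathcomp Require Import ring zify.
Import Order.TTheory GRing.Theory Num.Theory.
Local Open Scope ring_scope.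

(** * Catalan numbers and the truncated negative binomial series *)

(** Consecutive central binomials are compared through ['C(2n+1, n)], giving $(n+1)\binom{2n+2}{n+1}
    = (4n+2)\binom{2n}{n}$. *)
Lemma catalanS n : n.+2%:R * catalan n.+1 = (4 * n + 2)%:R * catalan n.
Proof.
have n1 : n.+1%:R != 0 :> rat by rewrite pnatr_eq0.
have n2 : n.+2%:R != 0 :> rat by rewrite pnatr_eq0.
have bin : (n.+1 * 'C((2 * n.+1)%N, n.+1) = (4 * n + 2) * 'C((2 * n)%N, n))%N.
  have /= e1 := mul_bin_diag (2 * n).+2 n.
  have /= e2 := mul_bin_down (2 * n).+1 n.
  rewrite (_ : ((2 * n).+1 - n)%N = n.+1) in e2; last by lia.
  rewrite (_ : (2 * n.+1 = (2 * n).+2)%N); last by lia.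
  rewrite -e1 (_ : (2 * n).+2 = 2 * n.+1)%N; last by lia.
  by rewrite -mulnA -e2; lia.
rewrite /catalan mulrCA divff // mulr1 mulrA -natrM -bin natrM mulrAC divff //.
by rewrite mul1r.
Qed.

(** By induction: symmetry turns $(n+3) S$ into twice the sum weighted by $i+1$, and [catalanS]
    absorbs that weight, lowering the convolution by one degree. *)
Lemma catalan_conv n :
  \sum_(i < n.+1) catalan i * catalan (n - i) = catalan n.+1.
Proof.
(* Reversing the sum replaces the weight [i] by the average [m / 2]. *)
have wsum m : 2%:R * \sum_(i < m.+1) i%:R * (catalan i * catalan (m - i)) =
    m%:R * \sum_(i < m.+1) catalan i * catalan (m - i).
  rewrite mulr_natl mulr2n [X in X + _](reindex_inj rev_ord_inj) /= mulr_sumr.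
  rewrite -big_split /=; apply: eq_bigr => i _; rewrite subSS.
  have im : (i <= m)%N by rewrite -ltnS.
  rewrite subKn // [catalan (m - i) * _]mulrC -mulrDl natrB //.
  by rewrite subrK.
elim: n => [|n IHn].
  by rewrite big_ord1 /catalan; apply/eqP.
have n3 : n.+3%:R != 0 :> rat by rewrite pnatr_eq0.
set S := LHS.
apply: (mulfI n3); rewrite catalanS.
have -> : n.+3%:R * S = 2%:R *
   \sum_(i < n.+2) (i.+1)%:R * (catalan i * catalan (n.+1 - i)).
  under eq_bigr => i _ do rewrite -natr1 mulrDl mul1r.
  by rewrite big_split mulrDr wsum -/S -mulrDl -natrD addn2.
rewrite big_ord_recl /= subn0 mul1r.
under eq_bigr => i _ do
  rewrite /bump /= add1n subSS mulrA catalanS -(mulrA _%:R) natrD natrM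
          mulrDl -[_ * _ * (_ * _)]mulrA.
rewrite big_split -!mulr_sumr /= (_ : 4%:R = 2%:R * 2%:R :> rat) //.
rewrite -[2%:R * 2%:R * _]mulrA wsum IHn (_ : catalan 0 = 1); last by apply/eqP.
rewrite natrD natrM -[n.+1%:R]natr1; ring.
Qed.

(** A finite form of $(1-v)^{-r-1} = \sum_m \binom{m+r}{m} v^m$, with the tail kept as a multiple of
    $v^M$. Multiplying by $1-v$ lowers $r$ by Pascal's rule. *)
Lemma inv_binomial_expansion (R : comNzRingType) (v : R) r M : exists s,
  (1 - v) ^+ r.+1 * (\sum_(m < M) 'C(m + r, m)%:R * v ^+ m) = 1 + v ^+ M * s.
Proof.
elim: r => [|r [s IHr]].
  exists (- 1); elim: M => [|M IHM]; first by rewrite big_ord0; ring.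
  by rewrite big_ord_recr /= mulrDr IHM addn0 binn [v ^+ M.+1]exprS expr1; ring.
have [c step] : exists c, (1 - v) * (\sum_(m < M) 'C(m + r.+1, m)%:R * v ^+ m) =
    \sum_(m < M) 'C(m + r, m)%:R * v ^+ m - c * v ^+ M.
  (* The last coefficient of the sum, which $-v$ pushes out to degree $M$; it is 0 for the empty
     sum. *)
  exists (if M is M'.+1 then 'C(M' + r.+1, M')%:R else 0).
  elim: M {s IHr} => [|M IHM]; first by rewrite !big_ord0; ring.
  rewrite !big_ord_recr /= mulrDr IHM; case: M {IHM} => [|M].
    by rewrite !bin0 expr1 expr0; ring.
  have -> : 'C(M.+1 + r.+1, M.+1) = ('C(M + r.+1, M.+1) + 'C(M + r.+1, M))%N.
    by rewrite addSn binS.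
  by rewrite addSnnS natrD !exprS; ring.
exists (s - (1 - v) ^+ r.+1 * c).
by rewrite exprSr -mulrA step mulrBr IHr; ring.
Qed.

(** * Coefficients of formal power series *)

Section FpsLemmas.
Variable R : fieldType.
Implicit Types f g : fps R.

Lemma coefsXM f n : coefs (fpsX * f) n = if n is m.+1 then coefs f m else 0.
Proof.
rewrite coefsM; case: n => [|n]; first by rewrite big_ord1 mul0r.
rewrite !big_ord_recl /= mul0r add0r mul1r big1 ?addr0 ?subn1 // => i _.
by rewrite mul0r.
Qed.

Lemma coefsXnM f n i :
  coefs (fpsX ^+ n * f) i = if (i < n)%N then 0 else coefs f (i - n).
Proof.
elim: n i => [|n IHn] i; first by rewrite expr0 mul1r subn0.
by rewrite exprS -mulrA coefsXM; case: i => [|i] //; rewrite IHn.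
Qed.

Lemma coefs_sum (I : Type) (r : seq I) (F : I -> fps R) n :
  coefs (\sum_(i <- r) F i) n = \sum_(i <- r) coefs (F i) n.
Proof. exact: (big_morph (fun f => coefs f n)). Qed.

Definition fpsC (c : R) : fps R := Fps (fun n => c *+ (n == 0%N)).

Lemma coefsCM c f n : coefs (fpsC c * f) n = c * coefs f n.
Proof.
rewrite coefsM big_ord_recl /= subn0 big1 ?addr0 // => i _.
by rewrite mul0r.
Qed.

Lemma fpsC_is_zmod_morphism : zmod_morphism fpsC.
Proof. by move=> c d; apply/fpsP => n /=; rewrite mulrnBl. Qed.

Lemma fpsC_is_monoid_morphism : monoid_morphism fpsC.
Proof.
split=> [|c d]; apply/fpsP => n; first by rewrite coefs1.
by rewrite coefsCM /= mulrnAr.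
Qed.

HB.instance Definition _ := GRing.isZmodMorphism.Build R (fps R) fpsC fpsC_is_zmod_morphism.
HB.instance Definition _ :=
  GRing.isMonoidMorphism.Build R (fps R) fpsC fpsC_is_monoid_morphism.

Lemma coefs_natM m f n : coefs (m%:R * f) n = m%:R * coefs f n.
Proof. by rewrite -(rmorph_nat fpsC) coefsCM. Qed.

End FpsLemmas.

(** * Enumeration of paths by their first step *)

Definition steps (k n h : nat) : seq step :=
  if n is 0 then [::] else
  Up :: nseq (0 < h)%N Down ++
    [seq Hor l c | l <- iota 1 n, c <- iota 0 (kfib k l)].

Definition step_len (s : step) : nat := if s is Hor l _ then l else 1%N.

Definition step_height (s : step) (h : nat) : nat :=
  match s with Up => h.+1 | Down => h.-1 | Hor _ _ => h end.

(* The first argument is fuel; [n] is enough, every step having positive length. *)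
Fixpoint paths_from (k f n h : nat) : seq (seq step) :=
  nseq ((n == 0%N) && (h == 0%N)) [::] ++
  if f is f'.+1 then
    [seq s :: p | s <- steps k n h,
                  p <- paths_from k f' (n - step_len s) (step_height s h)]
  else [::].

(** Endpoints are relative to the start, so a path from height [h] down to the axis ends at [- h].
    Arbitrary [h] makes the class stable under removal of the first step. *)
Definition path_from (k n h : nat) (p : seq step) : Prop :=
  [/\ all (valid_step k) p, endpoint p = (n%:Z, - h%:Z)
    & forall i, 0 <= h%:Z + (endpoint (take i p)).2].

Lemma endpoint_cons s p : endpoint (s :: p) = step_vec s + endpoint p.
Proof. by rewrite /endpoint big_cons. Qed.

Lemma endpoint_nil : endpoint [::] = 0.
Proof. by rewrite /endpoint big_nil. Qed.

Lemma mem_steps k n h s :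
  s \in steps k n h = [&& valid_step k s, (step_len s <= n)%N &
                          if s is Down then (0 < h)%N else true].
Proof.
case: n => [|n]; first by case: s => [||[|l] c] //=; rewrite ?andbF.
have up_hor t : t \in [seq Hor l c | l <- iota 1 n.+1, c <- iota 0 (kfib k l)] =
    if t is Hor l c then [&& 0 < l, l <= n.+1 & c < kfib k l]%N else false.
  apply/allpairsPdep/idP.
    by move=> [l [c []]]; rewrite !mem_iota => hl hc ->; lia.
  by case: t => // l c h3; exists l, c; rewrite !mem_iota; split=> //; lia.
rewrite /steps in_cons mem_cat mem_nseq up_hor.
case: s => [||l c] //=; first by case: h.
by rewrite andbF /=; lia.
Qed.

Lemma uniq_steps k n h : uniq (steps k n h).
Proof.
case: n => // n; rewrite /steps cons_uniq mem_cat mem_nseq andbF orFb cat_uniq.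
have horP t : t \in [seq Hor l c | l <- iota 1 n.+1, c <- iota 0 (kfib k l)] ->
    if t is Hor _ _ then true else false.
  by case/allpairsPdep=> l [c [_ _ ->]].
apply/and4P; split.
- by apply/negP => /horP.
- by case: h.
- by apply/hasPn => -[||l c] /horP //; rewrite mem_nseq andbF.
- apply: allpairs_uniq_dep => [|l _|]; rewrite ?iota_uniq //.
  by move=> [l c] [l' c'] _ _ /= [-> ->].
Qed.

Lemma path_from_nil k n h : path_from k n h [::] <-> n = 0%N /\ h = 0%N.
Proof.
rewrite /path_from endpoint_nil; split=> [[_ [] nh]|[-> ->]]; first by move=> *; lia.
by split=> // i; rewrite take_nil endpoint_nil.
Qed.

Lemma endpoint_ge0 p : 0 <= (endpoint p).1.
Proof.
elim: p => [|s p IHp]; first by rewrite endpoint_nil.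
by rewrite endpoint_cons addr_ge0 //; case: s.
Qed.

(** The side condition excludes a fall from height 0, where [h.-1] would be truncated. *)
Lemma step_vecE s h : is_true (if s is Down then (0 < h)%N else true) ->
  step_vec s = ((step_len s)%:Z, (step_height s h)%:Z - h%:Z).
Proof. by case: s => [||l c] /= h0; congr (_, _); lia. Qed.

Lemma path_from_cons k n h s p : path_from k n h (s :: p) <->
  s \in steps k n h /\ path_from k (n - step_len s) (step_height s h) p.
Proof.
rewrite mem_steps /path_from; split.
  case=> /= /andP[vs vp] e pos.
  (* The prefix of length 1 must not go below the axis. *)
  have dn : is_true (if s is Down then (0 < h)%N else true).
    case: s {vs e} pos => // /(_ 1%N).
    by rewrite /= take0 endpoint_cons endpoint_nil addr0 /=; lia.
  move: e; rewrite endpoint_cons (step_vecE _ _ dn).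
  have := endpoint_ge0 p; case ep: (endpoint p) => [a b] /= a0 [ea eb].
  rewrite vs dn; split; first by lia.
  split=> //; first by congr (_, _); lia.
  move=> i; have := pos i.+1; rewrite /= endpoint_cons (step_vecE _ _ dn) /=.
  by lia.
case=> /and3P[vs ln dn] [vp ep pos]; split; first by rewrite /= vs.
  by rewrite endpoint_cons (step_vecE _ _ dn) ep; congr (_, _) => /=; lia.
case=> [|i]; first by rewrite take0 endpoint_nil addr0.
rewrite /= endpoint_cons (step_vecE _ _ dn) /=; have := pos i; lia.
Qed.

Lemma mem_paths_from k f n h p : (n <= f)%N ->
  p \in paths_from k f n h <-> path_from k n h p.
Proof.
elim: f n h p => [|f IHf] n h p nf.
  have {nf}-> : n = 0%N by lia.
  case: p => [|s p].
    by rewrite path_from_nil /= cats0 mem_nseq; split=> [|[_ ->]] //; case: h.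
  rewrite path_from_cons mem_steps /= cats0 mem_nseq andbF; split=> // -[/and3P[]].
  by case: s => [||[|l] c].
rewrite [paths_from _ _ _ _]/= mem_cat mem_nseq; case: p => [|s p].
  rewrite path_from_nil; split=> [|[-> ->]] //.
  by case/orP=> [|/allpairsPdep[? [? []]]] //; do 2?[case: eqP => //].
rewrite path_from_cons andbF /=; split=> [/allpairsPdep[s' [p' [s's p'p [-> ->]]]]|[sS pp]].
  split=> //; apply/IHf => //; move: s's; rewrite mem_steps.
  by case: (s') => [||[|l] c] //=; lia.
apply/allpairsPdep; exists s, p; split=> //; apply/IHf => //; move: sS.
by rewrite mem_steps; case: (s) => [||[|l] c] //=; lia.
Qed.

Lemma uniq_paths_from k f n h : uniq (paths_from k f n h).
Proof.
elim: f n h => [|f IHf] n h /=; first by rewrite cats0; case: (_ && _).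
rewrite cat_uniq; apply/and3P; split; first by case: (_ && _).
  by apply/hasPn => _ /allpairsPdep[s [p [_ _ ->]]]; rewrite mem_nseq andbF.
apply: allpairs_uniq_dep => [|s _|]; rewrite ?uniq_steps //.
by move=> [s p] [s' p'] _ _ /= [-> ->].
Qed.

Lemma coefs_kfib_path_gf k n :
  coefs (kfib_path_gf k) n = (size (paths_from k n n 0))%:R.
Proof.
rewrite /=; congr (_%:R).
have -> : kfib_paths k n = [set` [fset p in paths_from k n n 0]%fset]%classic.
  apply/seteqP; split=> p; rewrite /= inE mem_paths_from // /path_from oppr0 => -[vp ep pos];
    split=> // i; by have := pos i; rewrite add0r.
by rewrite set_fsetK card_fseq undup_id // uniq_paths_from.
Qed.

(** The three summands count paths opening with a rise, a fall and a coloured horizontal step of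
    length [i.+1]. *)
Lemma size_paths_from k f n h :
  size (paths_from k f.+1 n.+1 h) =
  (size (paths_from k f n h.+1) + (if h is h'.+1 then size (paths_from k f n h') else 0)
   + \sum_(i < n.+1) kfib k i.+1 * size (paths_from k f (n - i) h))%N.
Proof.
have -> : paths_from k f.+1 n.+1 h =
    [seq s :: p | s <- steps k n.+1 h,
                  p <- paths_from k f (n.+1 - step_len s) (step_height s h)].
  by [].
rewrite size_allpairs_dep sumnE big_map /steps big_cons big_cat addnA big_allpairs_dep.
rewrite -[iota 1 n.+1]/(index_iota 1 n.+2) big_add1 big_mkord.
congr ((_ + _) + _)%N; first by rewrite /= subSS subn0.
  by case: h => [|h]; rewrite /= ?big_nil // big_seq1 subSS subn0.
apply: eq_bigr => i _; rewrite /= subSS big_const_seq count_predT size_iota iter_addn_0.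
by rewrite mulnC.
Qed.

(** * Generating function of the k-Fibonacci numbers *)

Lemma coefs0_kfib_den k : coefs (kfib_den k) 0 = 1.
Proof. by rewrite /kfib_den !(coefsD, coefsN) coefs1 !coefs0M /= !mulr0 !subr0. Qed.

Lemma unit_kfib_den k : kfib_den k \is a GRing.unit.
Proof. by rewrite fps_unitE coefs0_kfib_den. Qed.

Lemma kfib_gf k : fpsX / kfib_den k = Fps (fun n => (kfib k n)%:R).
Proof.
have uQ := unit_kfib_den k.
apply: (mulIr uQ); rewrite divrK // mulrC; set F := Fps _.
have -> : kfib_den k * F = F - k%:R * (fpsX * F) - fpsX * (fpsX * F).
  by rewrite /kfib_den; ring.
apply/fpsP => n; rewrite !(coefsD, coefsN) coefs_natM /F.
case: n => [|[|n]]; rewrite !coefsXM ?mulr0 ?subr0 //=.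
by rewrite natrD natrM; ring.
Qed.

Lemma coefs_kfib_gfM k f n : coefs (fpsX / kfib_den k * f) n.+1 =
  \sum_(i < n.+1) (kfib k i.+1)%:R * coefs f (n - i).
Proof. by rewrite kfib_gf coefsM big_ord_recl /= mul0r add0r. Qed.

(** * Consequences of the quadratic equation $b T = 1 + z^2 T^2$ *)

Section PathSeries.
Variables (k : nat) (T : fps rat).
Local Notation z := (fpsX : fps rat).
Local Notation b := (1 - z / kfib_den k).
Hypothesis quadT : b * T = 1 + z ^+ 2 * T ^+ 2.

Let coefs0_b : coefs b 0 = 1.
Proof. by rewrite coefsD coefsN coefs0M coefs1 /= mul0r subr0. Qed.

Let coefs0T : coefs T 0 = 1.
Proof.
move/(congr1 (fun f => coefs f 0)): quadT.
by rewrite coefsD !coefs0M coefs0_b coefs1 /= !mul0r addr0 mul1r.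
Qed.

(* The formula comes from the first-passage decomposition: a path from height
   [h] down to [0] is a sequence of [h + 1] paths from [0] to [0] separated by
   [h] falls. *)
Lemma size_paths_from_coefs f n h : (n <= f)%N ->
  (size (paths_from k f n h))%:R = coefs (z ^+ h * T ^+ h.+1) n.
Proof.
have base m : coefs (z ^+ m * T ^+ m.+1) 0 = (m == 0)%:R.
  by rewrite coefsXnM; case: m => [|m] //; rewrite expr1 coefs0T.
elim: f n h => [|f IHf] [|n] h // nf.
- by rewrite base size_cat size_nseq addn0.
- by rewrite base size_cat size_nseq addn0.
rewrite size_paths_from // !natrD natr_sum IHf //.
(* This is [quadT] times $z^h T^h$. The terms match a fall, a rise and a horizontal step; for
   [h = 0] the first one is the constant 1, which is invisible in degree [n.+1], as no fall is
   possible. *)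
have -> : z ^+ h * T ^+ h.+1 = z ^+ h * T ^+ h + z * (z ^+ h.+1 * T ^+ h.+2) +
    (z / kfib_den k) * (z ^+ h * T ^+ h.+1).
  have -> : z / kfib_den k = 1 - b by ring.
  rewrite mulrBl mul1r [T ^+ h.+1]exprS.
  rewrite (_ : b * (z ^+ h * (T * T ^+ h)) = z ^+ h * T ^+ h * (b * T)); last by ring.
  by rewrite quadT !exprS; ring.
rewrite !coefsD coefsXM coefs_kfib_gfM [_ + coefs _ n]addrC.
congr (_ + _ + _).
  case: h => [|h]; first by rewrite !expr0 mulr1 coefs1.
  by rewrite IHf // [z ^+ h.+1]exprS -mulrA coefsXM.
apply: eq_bigr => i _; rewrite natrM IHf //.
by rewrite (leq_trans (leq_subr _ _)).
Qed.

Lemma kfib_path_gf_unique : kfib_path_gf k = T.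
Proof.
apply/fpsP => n; rewrite coefs_kfib_path_gf size_paths_from_coefs //.
by rewrite expr0 mul1r.
Qed.

Lemma cfrac_cvg :
  fps_cvg (cfrac (fun i => if i == 0%N then 1 else - z ^+ 2) (fun=> b) 0) T.
Proof.
set a := fun i => _.
(* Such a [d] has constant term 0, so $b + d$ has constant term 1. *)
have unitD d e n : d + z ^+ 2 * T = z ^+ n.+1 * e -> b + d \is a GRing.unit.
  move/(canRL (addrK _)) => ->; rewrite fps_unitE coefsD coefs0_b coefsD coefsN.
  by rewrite !exprS -!mulrA !coefsXM.
have tail n i : exists e,
    cfrac a (fun=> b) i.+1 n + z ^+ 2 * T = z ^+ (2 * n).+2 * e.
  elim: n i => [|n IHn] i; first by exists T; rewrite add0r.
  have [e de] := IHn i.+1; set d := cfrac _ _ _ _ in de.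
  have uD := unitD _ _ _ de.
  (* By [quadT], $-z^2/(b+d) + z^2 T = z^2 T (d + z^2 T)/(b+d)$: each level gains a factor $z^2$. *)
  exists (T * e / (b + d)); apply: (mulIr uD).
  rewrite [cfrac _ _ _ _]/= -/d [a _](_ : _ = - z ^+ 2) // mulrDl divrK // !mulrA divrK //.
  transitivity (z ^+ 2 * (b * T + T * d - 1)); first by ring.
  rewrite quadT [LHS](_ : _ = z ^+ 2 * T * (d + z ^+ 2 * T)); last by ring.
  rewrite de (_ : (2 * n.+1).+2 = (2 + (2 * n).+2)%N); last by lia.
  by rewrite exprD; ring.
move=> N; exists N.+1 => -[|m] // Nm i iN.
have [e de] := tail m 0%N; set d := cfrac _ _ _ _ in de.
have uD := unitD _ _ _ de.
rewrite [cfrac _ _ _ _]/= -/d.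
(* The head has numerator 1, and $1/(b+d) - T = -T (d + z^2 T)/(b+d)$. *)
have -> : 1 / (b + d) = T + z ^+ (2 * m).+2 * (- (T * e) / (b + d)).
  apply: (mulIr uD); rewrite mulrDl divrK // mulrA divrK //.
  rewrite [X in _ = X + _](_ : _ = b * T + T * d); last by ring.
  rewrite quadT (_ : _ * - (T * e) = - (T * (z ^+ (2 * m).+2 * e))); last by ring.
  by rewrite -de; ring.
by rewrite coefsD coefsXnM ifT ?addr0 //; lia.
Qed.

Lemma coefs_catalan_expansion t : coefs T t =
  \sum_(0 <= n < t.+1) \sum_(0 <= m < (t.+1 - 2 * n)%N)
     'C((m + 2 * n)%N, m)%:R * catalan n * conv_kfib k m (t - 2 * n - m + 1)%N.
Proof.
have ub : b \is a GRing.unit by rewrite fps_unitE coefs0_b oner_eq0.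
(* The Catalan series is cut to a polynomial so that it can be evaluated at $w = z^2 b^{-2}$; its
   functional equation then holds up to a multiple of ['X^N]. *)
pose N := t.+1; pose p : {poly fps rat} := \poly_(i < N) fpsC _ (catalan i).
have [r pE] : exists r, p = 1 + 'X * p ^+ 2 + r * 'X^N.
  set q := p - (1 + 'X * p ^+ 2).
  (* Below degree [N] the coefficients of [q] vanish by [catalan_conv]. *)
  suff q0 : take_poly N q = 0.
    exists (drop_poly N q); rewrite -[LHS](subrK (1 + 'X * p ^+ 2)) -/q addrC.
    by rewrite -{1}[q](poly_take_drop N) q0 add0r.
  apply/polyP => i; rewrite coef_take_poly coef0; case: ltnP => // iN.
  rewrite coefB coefD coef1 coefXM coef_poly iN; case: i iN => [|i] iN /=.
    by rewrite addr0 (_ : catalan 0 = 1) ?rmorph1 ?subrr //; apply/eqP.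
  rewrite add0r expr2 coefM -catalan_conv rmorph_sum -sumrB big1 //= => j _.
  rewrite !coef_poly !ifT ?rmorphM ?subrr //; have := ltn_ord j; lia.
pose w := z ^+ 2 * b^-1 ^+ 2; pose U := b^-1 * p.[w].
have bU : b * U = 1 + z ^+ 2 * U ^+ 2 + z ^+ (2 * N) * (b^-1 ^+ (2 * N) * r.[w]).
  have pwE : p.[w] = 1 + w * p.[w] ^+ 2 + r.[w] * w ^+ N.
    by rewrite {1}pE !(hornerD, hornerM, horner_exp, hornerX) hornerC.
  by rewrite /U mulVKr // {1}pwE [w ^+ N]exprMn -!exprM /w; ring.
(* Subtracting the two quadratic equations leaves $(T-U)(b - z^2(U+T))$, whose second factor is a
   unit, so [T] and [U] agree below degree $2N > t$. *)
have TU : T = U + z ^+ (2 * N) * (- (b^-1 ^+ (2 * N) * r.[w]) / (b - z ^+ 2 * (U + T))).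
  have uD : b - z ^+ 2 * (U + T) \is a GRing.unit.
    rewrite fps_unitE coefsD coefs0_b coefsN expr2 -mulrA coefsXM subr0.
    exact: oner_neq0.
  apply: (mulIr uD); rewrite mulrDl mulrA divrK //.
  apply/eqP; rewrite -subr_eq0; apply/eqP.
  transitivity ((b * T - z ^+ 2 * T ^+ 2) - (b * U - z ^+ 2 * U ^+ 2) +
      z ^+ (2 * N) * (b^-1 ^+ (2 * N) * r.[w])); first by ring.
  by rewrite bU quadT; ring.
rewrite TU coefsD coefsXnM ifT ?addr0; last by lia.
rewrite /U horner_poly mulr_sumr coefs_sum big_mkord; apply: eq_bigr => n _.
rewrite mulrCA coefsCM /w exprMn -!exprM mulrCA -exprS coefsXnM.
(* When $t < 2n$ the truncated bound makes the inner sum empty. *)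
case: ltnP => [tn|nt].
  by rewrite big_geq ?mulr0 // leq_subLR addn0.
(* Since $b = 1 - z/Q$, $b^{-(2n+1)}$ is expanded in $z/Q$; with $t+1-2n$ terms the remainder starts
   just above the degree $t-2n$ that is read off. *)
have [s] := inv_binomial_expansion _ (z / kfib_den k) (2 * n) (t.+1 - 2 * n).
move/(canRL (mulKr (unitrX _ ub))); rewrite mulrDr mulr1 -exprVn => sE.
set M := (t.+1 - 2 * n)%N in sE *.
have -> : b^-1 ^+ (2 * n).+1 = \sum_(m < M) 'C(m + 2 * n, m)%:R * (z / kfib_den k) ^+ m -
    z ^+ M * ((kfib_den k)^-1 ^+ M * (b^-1 ^+ (2 * n).+1 * s)).
  by rewrite sE exprMn; ring.
rewrite coefsD coefsN coefsXnM ifT ?subr0; last by rewrite /M subSn.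
rewrite coefs_sum mulr_sumr big_mkord; apply: eq_bigr => m _.
have mt : (m <= t - 2 * n)%N by rewrite -ltnS -subSn ?ltn_ord.
rewrite coefs_natM exprMn coefsXnM ltnNge mt.
by rewrite /conv_kfib addn1 /= exprVn; ring.
Qed.
End PathSeries.

(** * The square root formula as a solution of the quadratic equation *)

Theorem theorem3p3 (k : nat) (hk : (1 <= k)%N) :
  let z : fps rat := fpsX in
  let Q : fps rat := kfib_den k in
  let P : fps rat := 1 - k.+1%:R * z - z ^+ 2 in
  [/\ tofrac (kfib_path_gf k) =
        tofrac (P - fps_sqrt (P ^+ 2 - 4%:R * z ^+ 2 * Q ^+ 2)) /
        tofrac (2%:R * z ^+ 2 * Q) :> {fraction (fps rat)},
      fps_cvg (cfrac (fun i => if i == 0%N then 1 else - z ^+ 2)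
                     (fun _ => 1 - z / Q) 0)
              (kfib_path_gf k)
    & forall t : nat,
        coefs (kfib_path_gf k) t =
        \sum_(0 <= n < t.+1) \sum_(0 <= m < (t.+1 - 2 * n)%N)
          'C((m + 2 * n)%N, m)%:R * catalan n
            * conv_kfib k m (t - 2 * n - m + 1)%N].
Proof.
move=> z Q P; set D := P ^+ 2 - _; set S := fps_sqrt D.
have uQ : Q \is a GRing.unit := unit_kfib_den k.
have PQ : P = Q - z by rewrite /P /Q /kfib_den -[k.+1%:R]natr1 -/z; ring.
have coefs0P : coefs P 0 = 1.
  by rewrite PQ coefsD coefs0_kfib_den coefsN /= subr0.
have D0 : coefs D 0 = 1.
  rewrite (_ : D = P ^+ 2 - z ^+ 2 * (4%:R * Q ^+ 2)); last by rewrite /D; ring.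
  rewrite coefsD coefsN coefsXnM subr0.
  by rewrite expr2 coefs0M coefs0P mulr1.
have S2 : S ^+ 2 = D by apply: sqr_fps_sqrt.
have uPS : P + S \is a GRing.unit by rewrite fps_unitE coefsD coefs0P.
(* Rationalizing the numerator, this is [(P - S) / (2 z^2 Q)] without dividing by [z]. *)
pose T := 2%:R * Q / (P + S).
have TPS : T * (P + S) = 2%:R * Q by rewrite divrK.
have quadT : (1 - z / Q) * T = 1 + z ^+ 2 * T ^+ 2.
  have -> : 1 - z / Q = P / Q by rewrite PQ mulrBl divrr.
  (* Clearing denominators with $Q (P+S)^2$ turns every [T] into $T (P+S) = 2Q$. *)
  apply: (mulIr uQ); apply: (mulIr uPS); apply: (mulIr uPS).
  have -> : P / Q * T * Q * (P + S) * (P + S) = P * (T * (P + S)) * (P + S) * (Q / Q).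
    by ring.
  have -> : (1 + z ^+ 2 * T ^+ 2) * Q * (P + S) * (P + S) =
    Q * (P ^+ 2 + 2%:R * P * S + S ^+ 2 + z ^+ 2 * (T * (P + S)) ^+ 2) by ring.
  by rewrite divrr // TPS S2 /D; ring.
have -> := kfib_path_gf_unique _ _ quadT.
split; last exact: coefs_catalan_expansion; last exact: cfrac_cvg.
(* The denominator is not invertible as a series, only nonzero, hence the quotient in the fraction
   field. *)
have den0 : 2%:R * z ^+ 2 * Q != 0.
  have z0 : z != 0 by apply/eqP => /(congr1 (fun f => coefs f 1)) /eqP.
  have two0 : (2%:R : fps rat) != 0.
    by apply/eqP => /(congr1 (fun f => coefs f 0)) /eqP.
  have Q0 : Q != 0 by apply: contraTneq uQ => ->; rewrite unitr0.
  by rewrite !mulf_neq0 ?expf_neq0.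
apply: (canRL (mulfK _)); first by rewrite tofrac_eq0.
(* Back among series, multiplying by $P + S$ reduces the claim to $P^2 - S^2 = 4 z^2 Q^2$. *)
rewrite -tofracM; congr tofrac; apply: (mulIr uPS).
rewrite mulrAC TPS.
have -> : (P - S) * (P + S) = P ^+ 2 - S ^+ 2 by ring.
by rewrite S2 /D; ring.
Qed.
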